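(* Let $q\ge 3$ be odd, and let $H$ be a graph of odd girth $q$ that does not contain $C_4$ as a subgraph. Then there is an infinite family of pairwise non-isomorphic minimal obstructions to $H$-coloring, each of which is $P_{3q-1}$-free, $S_{2,2,2}$-free, and $S_{3(q-1)/2,\,3(q-1)/2,\,1}$-free.
   Context: All graphs are finite and simple. For graphs $G$ and $H$, an $H$-coloring of $G$ is a map $c: V(G)\to V(H)$ such that $c(u)c(v)\in E(H)$ for every edge $uv\in E(G)$. A graph $G$ is a minimal obstruction to $H$-coloring if $G$ has no $H$-coloring but every proper induced subgraph of $G$ has an $H$-coloring. The odd girth of a non-bipartite graph is the length of a shortest odd cycle in it. $C_4$ is the cycle on four vertices (''subgraph'' means not necessarily induced), and $P_t$ is the path on $t$ vertices. For integers $a,b,c\ge 1$, $S_{a,b,c}$ is the graph obtained from the paths $P_{a+1},P_{b+1},P_{c+1}$ by identifying one endvertex of each of them into a single vertex. A graph is $F$-free if it does not contain $F$ as an induced subgraph. *)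

(* Defs.v *)
From mathcomp Require Import all_boot.

Set Implicit Arguments.
Unset Strict Implicit.
Unset Printing Implicit Defensive.

Record sgraph : Type := SGraph {
  vertex :> finType;
  edge : rel vertex;
  edge_sym : symmetric edge;
  edge_irrefl : irreflexive edge
}.

Definition is_hom (G H : sgraph) (c : G -> H) : Prop :=
  forall u v : G, edge u v -> edge (c u) (c v).

Definition colorable (H G : sgraph) : Prop := exists c : G -> H, is_hom c.

Section Induced.
Variables (G : sgraph) (A : {set G}).

Definition induced_rel : rel {x : G | x \in A} :=
  fun x y => edge (val x) (val y).

Lemma induced_sym : symmetric induced_rel.
Proof. by move=> x y; apply: edge_sym. Qed.

Lemma induced_irrefl : irreflexive induced_rel.
Proof. by move=> x; apply: edge_irrefl. Qed.

Definition induced : sgraph := SGraph induced_sym induced_irrefl.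

End Induced.

Definition minimal_obstruction (H G : sgraph) : Prop :=
  ~ colorable H G /\
  forall A : {set G}, A \proper [set: G] -> colorable H (induced A).

Definition isomorphic (G H : sgraph) : Prop :=
  exists f : G -> H, bijective f /\ forall u v : G, edge (f u) (f v) = edge u v.

Definition contains_subgraph (F G : sgraph) : Prop :=
  exists f : F -> G, injective f /\ is_hom f.

Definition contains_induced (F G : sgraph) : Prop :=
  exists f : F -> G,
    injective f /\ forall u v : F, edge (f u) (f v) = edge u v.

Definition induced_free (F G : sgraph) : Prop := ~ contains_induced F G.

Definition consecutive (i j : nat) : bool := (i.+1 == j) || (j.+1 == i).

Lemma consecutive_sym : symmetric consecutive.
Proof. by move=> i j; apply: orbC. Qed.

Lemma consecutive_irrefl : irreflexive consecutive.
Proof. by move=> i; rewrite /consecutive orbb; elim: i. Qed.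

Section PathGraph.
Variable t : nat.

Definition path_rel : rel 'I_t := fun i j => consecutive i j.

Lemma path_rel_sym : symmetric path_rel.
Proof. by move=> i j; apply: consecutive_sym. Qed.

Lemma path_rel_irrefl : irreflexive path_rel.
Proof. by move=> i; apply: consecutive_irrefl. Qed.

(* [t] is the number of vertices. *)
Definition path_graph : sgraph := SGraph path_rel_sym path_rel_irrefl.

End PathGraph.

Section CycleGraph.
Variable n : nat.

Definition cycle_rel : rel 'I_n :=
  fun i j => (i != j) && ((i.+1 %% n == j) || (j.+1 %% n == i)).

Lemma cycle_rel_sym : symmetric cycle_rel.
Proof. by move=> i j; rewrite /cycle_rel eq_sym orbC. Qed.

Lemma cycle_rel_irrefl : irreflexive cycle_rel.
Proof. by move=> i; rewrite /cycle_rel eqxx. Qed.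

(* A cycle only for [3 <= n]. *)
Definition cycle_graph : sgraph := SGraph cycle_rel_sym cycle_rel_irrefl.

End CycleGraph.

Definition has_cycle (G : sgraph) (n : nat) : Prop :=
  3 <= n /\ contains_subgraph (cycle_graph n) G.

(* A relation rather than a function: it holds for no [q] if [G] has no odd
   cycle, that is, if [G] is bipartite. *)
Definition has_odd_girth (G : sgraph) (q : nat) : Prop :=
  [/\ odd q, has_cycle G q & forall n, odd n -> has_cycle G n -> q <= n].

(* [None] is the vertex shared by the three paths; the element [i] of a summand
   is the vertex at distance [i.+1] from it on the corresponding path. *)
Section Spider.
Variables a b c : nat.

Definition spider_vertex : finType := option ('I_a + 'I_b + 'I_c)%type.

Definition spider_depth (x : spider_vertex) : nat :=
  match x with
  | None => 0
  | Some (inl (inl i)) => i.+1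
  | Some (inl (inr i)) => i.+1
  | Some (inr i) => i.+1
  end.

Definition same_leg (x y : spider_vertex) : bool :=
  match x, y with
  | None, _ | _, None => true
  | Some (inl (inl _)), Some (inl (inl _)) => true
  | Some (inl (inr _)), Some (inl (inr _)) => true
  | Some (inr _), Some (inr _) => true
  | _, _ => false
  end.

Definition spider_rel : rel spider_vertex :=
  fun x y => same_leg x y && consecutive (spider_depth x) (spider_depth y).

Lemma spider_rel_sym : symmetric spider_rel.
Proof.
by move=> x y; rewrite /spider_rel consecutive_sym;
  case: x => [[[?|?]|?]|]; case: y => [[[?|?]|?]|].
Qed.

Lemma spider_rel_irrefl : irreflexive spider_rel.
Proof. by move=> x; rewrite /spider_rel consecutive_irrefl andbF. Qed.

Definition spider : sgraph := SGraph spider_rel_sym spider_rel_irrefl.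

End Spider.

(* Main.v *)
(** The obstructions are circulant-like graphs on [N] cyclically ordered
    vertices, [N = -2] modulo [q], where two vertices are adjacent if they are
    consecutive or if their distance is [-1] modulo [q] (this is symmetric by
    the choice of [N]).

    Any [q] consecutive vertices form a [q]-cycle, and the vertices [i] and
    [i + q] have the common neighbours [i + 1] and [i + q - 1], whose colours
    differ by the odd girth of [H].  As [H] has no [C_4], the colours of [i] and
    [i + q] agree.  Since [q] is odd, hence coprime to [N], all colours are
    equal, which is absurd.

    Once a vertex is deleted, the graph embeds in the graph on [nat] where [x]
    and [y] with [y = x + 1] modulo [q] are adjacent iff [y <= x + 1].
    Reduction modulo [q] maps it to [C_q], hence to [H].  Between consecutive
    residue classes it is a chain graph, so it has no induced [2K_2] there;
    this confines induced paths and spiders.  Lifting the residues along an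
    induced path on [3q - 2] vertices to integer heights, the heights of every
    third vertex must be consecutive, so that these vertices pass through all
    residue classes. *)

Require Import Defs.
From mathcomp Require Import all_boot.
From mathcomp Require Import zify.

Set Implicit Arguments.
Unset Strict Implicit.
Unset Printing Implicit Defensive.

(** * The graph [ladj] on the naturals *)

Definition up (q x y : nat) : bool := (y == x.+1 %[mod q]) && (y <= x.+1).

Definition ladj (q x y : nat) : bool := up q x y || up q y x.

Lemma upP q x y : reflect (y = x.+1 %[mod q] /\ y <= x.+1) (up q x y).
Proof. by apply: (iffP andP) => -[/eqP]. Qed.

Lemma ladjC q x y : ladj q x y = ladj q y x.
Proof. exact: orbC. Qed.

Lemma eqmodS q x y : x = y %[mod q] -> x.+1 = y.+1 %[mod q].
Proof. by move=> e; rewrite -addn1 -modnDml e modnDml addn1. Qed.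

Lemma eqmodSI q x y : x.+1 = y.+1 %[mod q] -> x = y %[mod q].
Proof. by move/eqP; rewrite -[x.+1]addn1 -[y.+1]addn1 eqn_modDr => /eqP. Qed.

(* The graph between two consecutive residue classes is a chain graph, so it has
   no induced [2K_2]. *)
Lemma up_cross q x y x' y' :
  x = x' %[mod q] -> up q x y -> up q x' y' -> up q x y' || up q x' y.
Proof.
move=> /eqmodS e /upP[cy ly] /upP[cy' ly'].
by rewrite /up cy cy' -e !eqxx /=; move: ly ly'; clear; lia.
Qed.

Lemma nonup_lt q x y : y = x.+1 %[mod q] -> ~~ up q x y -> x.+1 < y.
Proof. by move=> e; rewrite /up e eqxx -ltnNge. Qed.

(** * Integer heights along induced paths *)

Definition lifted_path (q m : nat) (v h : nat -> nat) : Prop :=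
  [/\ forall i, i < m -> v i = h i %[mod q],
      forall i, i.+1 < m ->
        (h i.+1 = (h i).+1 /\ up q (v i) (v i.+1)) \/
        (h i = (h i.+1).+1 /\ up q (v i.+1) (v i))
    & forall i j, i.+1 < j < m -> ~~ ladj q (v i) (v j)].

Lemma rev_lifted_path q m v h :
  lifted_path q m v h ->
  lifted_path q m (fun i => v (m.-1 - i)) (fun i => h (m.-1 - i)).
Proof.
case=> cl st na; split=> [i lim|i lim|i j lij].
- by apply: cl; lia.
- have -> : m.-1 - i = (m.-1 - i.+1).+1 by lia.
  by case: (st (m.-1 - i.+1)) => [|[]|[]]; [lia|right|left].
- by rewrite ladjC; apply: na; lia.
Qed.

Section LiftedPath.
Variables (q m : nat) (v h : nat -> nat).
Hypothesis vh : lifted_path q m v h.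

Lemma height_step i : i.+1 < m -> h i.+1 = (h i).+1 \/ h i = (h i.+1).+1.
Proof. by case: vh => _ st _ /st[[]|[]]; [left|right]. Qed.

Lemma height_lip i j : i + j < m -> h (i + j) <= h i + j /\ h i <= h (i + j) + j.
Proof.
elim: j => [|j IH]; first by rewrite !addn0.
by rewrite addnS => lm; have := height_step lm; have := IH ltac:(lia); lia.
Qed.

Lemma height_odd i : i < m -> odd (h i) = odd (h 0 + i).
Proof.
elim: i => [|i IH] lm; first by rewrite addn0.
by have := height_step lm; have := IH ltac:(lia); lia.
Qed.

Lemma height_crossing c n : n < m -> h 0 <= c < h n ->
  exists2 i, i < n & h i = c /\ h i.+1 = c.+1.
Proof.
elim: n => [|n IH] lm lc; first lia.
have [lcn|lnc] := ltnP c (h n).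
  by have [i li hi] := IH ltac:(lia) ltac:(lia); exists i => //; lia.
by exists n => //; have := height_step lm; lia.
Qed.

(** Otherwise [up_cross] forces an adjacency between [x] and [y'] or between [x'] and [y], which are
    too far apart on the path. *)
Lemma far_edges_differ x y x' y' :
  x < m -> y < m -> x' < m -> y' < m ->
  (x.+1 < y') || (y'.+1 < x) -> (x'.+1 < y) || (y.+1 < x') ->
  up q (v x) (v y) -> up q (v x') (v y') -> h x <> h x' %[mod q].
Proof.
case: vh => cl _ na lx ly lx' ly' d d' u u' e.
have nadj i j : i < m -> j < m -> (i.+1 < j) || (j.+1 < i) -> ~~ up q (v i) (v j).
  move=> li lj /orP[] d0.
    by have := na i j ltac:(lia); rewrite /ladj negb_or => /andP[].
  by have := na j i ltac:(lia); rewrite /ladj negb_or => /andP[].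
have := up_cross (_ : v x = v x' %[mod q]) u u'.
rewrite !cl // => /(_ e) /orP[]; apply/negP; exact: nadj.
Qed.

(** If the sign changed, the two middle steps would cancel and the outer two be opposite, giving two
    upward edges that start at equal height. *)
Lemma height_drift_const i : i.+4 < m -> (h i < h i.+3) = (h i.+1 < h i.+4).
Proof.
case: (vh) => _ st _ lm.
have [[h0 u0]|[h0 u0]] := st i ltac:(lia);
  have [[h1 _]|[h1 _]] := st i.+1 ltac:(lia);
  have [[h2 _]|[h2 _]] := st i.+2 ltac:(lia);
  have [[h3 u3]|[h3 u3]] := st i.+3 ltac:(lia); try lia;
  exfalso; refine (far_edges_differ _ _ _ _ _ _ u0 u3 _);
  by [lia | congr (_ %% _); lia].
Qed.

(** A higher rise would cross both levels [h 0] and [h 0 + q] upwards, by edges that start in the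
    same residue class. *)
Lemma height_range n : 3 <= q -> n < m -> h n <= h 0 + q.
Proof.
case: (vh) => _ st _ q3 lm; rewrite leqNgt; apply/negP => lt.
have [i li [hi hi']] := @height_crossing (h 0) n lm ltac:(lia).
have [j lj [hj hj']] := @height_crossing (h 0 + q) n lm ltac:(lia).
have [[_ ui]|[]] := st i ltac:(lia); last lia.
have [[_ uj]|[]] := st j ltac:(lia); last lia.
have d : (i + 3 <= j) || (j + 3 <= i).
  case: (leqP i j) => lij.
    by have := @height_lip i (j - i) ltac:(lia); rewrite subnKC //; lia.
  by have := @height_lip j (i - j) ltac:(lia); rewrite subnKC //; lia.
refine (far_edges_differ _ _ _ _ _ _ ui uj _); try lia.
by rewrite hi hj modnDr.
Qed.

(* If the heights drift upwards, [v 0, v 3, v 6, ...] run through all residue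
   classes in cyclic order without consecutive adjacencies, so that positions
   increase all the way around, contradicting the last non-adjacency. *)
Lemma no_ascending_path :
  3 <= q -> odd q -> m = 3 * q - 2 -> h 0 < h 3 -> False.
Proof.
case: (vh) => cl _ na q3 oq em h03.
have drift i : i.+3 < m -> h i < h i.+3.
  by elim: i => // i IH lm; rewrite -height_drift_const // IH //; lia.
(* As [q] is odd and [3 * q.-1] even, parity rules out the value [h 0 + q] that [height_range]
   allows. *)
have top : h (3 * q.-1) <= h 0 + q.-1.
  have := @height_range (3 * q.-1) q3 ltac:(lia).
  by have := @height_odd (3 * q.-1) ltac:(lia); lia.
have low k : k <= q.-1 -> h 0 + k <= h (3 * k).
  elim: k => [|k IH] lk; first by rewrite muln0 addn0.
  have -> : 3 * k.+1 = (3 * k).+3 by lia.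
  by have := drift (3 * k) ltac:(lia); have := IH ltac:(lia); lia.
have high k : k <= q.-1 -> h (3 * (q.-1 - k)) <= h 0 + (q.-1 - k).
  elim: k => [|k IH] lk; first by rewrite subn0.
  have := drift (3 * (q.-1 - k.+1)) ltac:(lia).
  have -> : (3 * (q.-1 - k.+1)).+3 = 3 * (q.-1 - k) by lia.
  by have := IH ltac:(lia); lia.
have hE k : k <= q.-1 -> h (3 * k) = h 0 + k.
  move=> lk; have := low k lk.
  by have := high (q.-1 - k) ltac:(lia); rewrite subKn //; lia.
have pos k : k <= q.-1 -> v 0 + k <= v (3 * k).
  elim: k => [|k IH] lk; first by rewrite muln0 addn0.
  have := na (3 * k) (3 * k.+1) ltac:(lia).
  rewrite /ladj negb_or => /andP[nu _].
  have /nonup_lt/(_ nu) : v (3 * k.+1) = (v (3 * k)).+1 %[mod q].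
    rewrite cl; last lia.
    rewrite hE // addnS -hE; last lia.
    by apply: eqmodS; rewrite cl //; lia.
  by have := IH ltac:(lia); lia.
have /negP := na 0 (3 * q.-1) ltac:(lia); apply.
apply/orP; right; apply/upP; split; last by have := pos q.-1 (leqnn _); lia.
have /eqmodS <- : h (3 * q.-1) = v (3 * q.-1) %[mod q] by rewrite cl //; lia.
rewrite hE // cl; last lia.
by rewrite -addnS prednK ?modnDr //; lia.
Qed.

End LiftedPath.

Lemma no_lifted_path q v h :
  3 <= q -> odd q -> ~ lifted_path q (3 * q - 2) v h.
Proof.
move=> q3 oq vh.
have [h03|h30] := ltnP (h 0) (h 3); first exact: (no_ascending_path vh).
have neg i : i.+3 < 3 * q - 2 -> h i.+3 <= h i.
  elim: i => // i IH lm.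
  have := height_drift_const vh (i := i) ltac:(lia).
  by have := IH ltac:(lia); lia.
apply: (no_ascending_path (rev_lifted_path vh)) => //=.
have e : (3 * q - 2).-1 - 0 = ((3 * q - 2).-1 - 3).+3 by lia.
rewrite e; set i := _ - 3.
(* Heights three steps apart have opposite parity, so the weak inequality is strict and the reversed
   path ascends. *)
have := neg i ltac:(lia).
have := height_odd vh (i := i) ltac:(lia).
by have := height_odd vh (i := i.+3) ltac:(lia); lia.
Qed.

Lemma no_induced_path q (v : nat -> nat) :
  3 <= q -> odd q ->
  ~ (forall i j, i < 3 * q - 2 -> j < 3 * q - 2 ->
       ladj q (v i) (v j) = consecutive i j).
Proof.
move=> q3 oq vP.
pose m := 3 * q - 2.
(* The base value is congruent to [v 0] and so large that [.-1] never truncates in the first [m]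
   steps. *)
pose h := fix h i := if i is i'.+1 then
  if up q (v i') (v i'.+1) then (h i').+1 else (h i').-1 else v 0 + m * q.
have hge i : v 0 + m * q <= h i + i.
  by elim: i => [|i IH] /=; [lia|case: ifP; lia].
have mq : m <= m * q by nia.
apply: (@no_lifted_path q v h) => //.
have st i : i.+1 < m ->
    (h i.+1 = (h i).+1 /\ up q (v i) (v i.+1)) \/
    (h i = (h i.+1).+1 /\ up q (v i.+1) (v i)).
  move=> lm; have /esym := vP i i.+1 ltac:(lia) lm.
  rewrite /consecutive eqxx /ladj /=.
  case: ifP => /= u uu; first by left.
  by right; split=> //; have := hge i; lia.
split=> // [i|i j lij].
  elim: i => [|i IH] lm; first by rewrite /= addnC modnMDl.
  have [[-> /upP[e _]]|[e /upP[e' _]]] := st i lm.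
    by rewrite e; apply: eqmodS; apply: IH; lia.
  by apply: eqmodSI; rewrite -e -e'; apply: IH; lia.
by rewrite vP /consecutive; lia.
Qed.

(** * Induced [S_{2,2,2}] with centre [c], middles [a i] and tips [b i] *)

Section LegDirections.
Variables (q c : nat) (a b : nat -> nat).
Hypothesis ca : forall i, i < 3 -> ladj q c (a i).
Hypothesis ab : forall i, i < 3 -> ladj q (a i) (b i).
Hypothesis abN : forall i j, i < 3 -> j < 3 -> i <> j -> ~~ ladj q (a i) (b j).

(** If both outer edges had the same direction, [up_cross] would join the middle of one leg to the
    tip of the other. *)
Lemma legs_turn i j : i < 3 -> j < 3 -> i <> j -> a i = a j %[mod q] ->
  up q (a i) (b i) = ~~ up q (a j) (b j).
Proof.
move=> li lj ij e.
have nij := abN li lj ij; have nji := abN lj li (not_eq_sym ij).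
case ui: (up q (a i) (b i)); case uj: (up q (a j) (b j)) => //=.
  have := up_cross e ui uj.
  by move: nij nji; rewrite /ladj !negb_or => /andP[/negPf-> _] /andP[/negPf-> _].
have := ab li; have := ab lj; rewrite /ladj ui uj /= => dj di.
have e' : b i = b j %[mod q].
  case/upP: (di) => ei _; case/upP: (dj) => ej _.
  by apply: eqmodSI; rewrite -ei -ej.
have := up_cross e' di dj.
by move: nij nji; rewrite /ladj !negb_or => /andP[_ /negPf->] /andP[_ /negPf->].
Qed.

Lemma two_legs_up i j k : i < 3 -> j < 3 -> k < 3 -> i <> j -> i <> k -> j <> k ->
  up q c (a i) -> up q c (a j) -> False.
Proof.
wlog uj: i j / ~~ up q (a j) (b j) => [IH|] li lj lk ij ik jk ui_c uj_c.
  have e : a i = a j %[mod q] by case/upP: ui_c => -> _; case/upP: uj_c => ->.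
  case uj: (up q (a j) (b j)); last by apply: (IH i j) => //; rewrite uj.
  apply: (IH j i) => //; last exact: not_eq_sym.
  by rewrite (legs_turn li lj ij e) uj.
have eij : a i = a j %[mod q] by case/upP: ui_c => -> _; case/upP: uj_c => ->.
have [uk_c|nuk_c] := boolP (up q c (a k)).
  have eik : a i = a k %[mod q] by case/upP: ui_c => -> _; case/upP: uk_c => ->.
  have := legs_turn li lj ij eij; have := legs_turn li lk ik eik.
  have := legs_turn lj lk jk (etrans (esym eij) eik).
  by move: uj; do 3!case: (up q _ _).
have := ca lk; rewrite /ladj (negPf nuk_c) /= => kc.
have := ab lj; rewrite /ladj (negPf uj) /= => bj.
have := abN li lj ij; rewrite /ladj negb_or => /andP[_ nij].
have := abN lk lj (not_eq_sym jk); rewrite /ladj negb_or => /andP[nkj _].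
case/upP: ui_c => e1 l1; case/upP: uj_c => e2 l2; case/upP: kc => e3 l3.
case/upP: bj => e4 l4.
(* Non-adjacency yields [c <= a k + 1 < b j] and [b j + 1 < a i <= c + 1], a contradiction. *)
have ebc : b j = c %[mod q] by apply: eqmodSI; rewrite -e4 e2.
have := nonup_lt (etrans e1 (eqmodS (esym ebc))) nij.
have := nonup_lt (etrans ebc e3) nkj.
by move: l1 l3; clear; lia.
Qed.

(** The argument of [two_legs_up] with all edges reversed. *)
Lemma two_legs_down i j k :
  i < 3 -> j < 3 -> k < 3 -> i <> j -> i <> k -> j <> k ->
  up q (a i) c -> up q (a j) c -> False.
Proof.
have cong x y : up q x c -> up q y c -> x = y %[mod q].
  by move=> /upP[ex _] /upP[ey _]; apply: eqmodSI; rewrite -ex -ey.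
wlog uj: i j / up q (a j) (b j) => [IH|] li lj lk ij ik jk ui_c uj_c.
  case uj: (up q (a j) (b j)); first by apply: (IH i j).
  apply: (IH j i) => //; last exact: not_eq_sym.
  by rewrite (legs_turn li lj ij (cong _ _ ui_c uj_c)) uj.
have [uk_c|nuk_c] := boolP (up q (a k) c).
  have := legs_turn li lj ij (cong _ _ ui_c uj_c).
  have := legs_turn li lk ik (cong _ _ ui_c uk_c).
  have := legs_turn lj lk jk (cong _ _ uj_c uk_c).
  by move: uj; do 3!case: (up q _ _).
have := ca lk; rewrite /ladj (negPf nuk_c) orbF => kc.
have := abN li lj ij; rewrite /ladj negb_or => /andP[nij _].
have := abN lk lj (not_eq_sym jk); rewrite /ladj negb_or => /andP[_ nkj].
case/upP: ui_c => e1 l1; case/upP: uj_c => e2 l2; case/upP: kc => e3 l3.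
case/upP: uj => e4 l4.
have ebc : b j = c %[mod q] by rewrite e4 -e2.
have := nonup_lt (etrans ebc e1) nij.
have := nonup_lt (etrans e3 (eqmodS (esym ebc))) nkj.
by move: l1 l3; clear; lia.
Qed.

(** Two of the three edges at [c] have the same direction. *)
Lemma no_three_legs : False.
Proof.
have [] := (ca (isT : 0 < 3), ca (isT : 1 < 3), ca (isT : 2 < 3)).
case=> /orP[] d0 /orP[] d1 /orP[] d2.
- exact: (@two_legs_up 0 1 2).
- exact: (@two_legs_up 0 1 2).
- exact: (@two_legs_up 0 2 1).
- exact: (@two_legs_down 1 2 0).
- exact: (@two_legs_up 1 2 0).
- exact: (@two_legs_down 0 2 1).
- exact: (@two_legs_down 0 1 2).
- exact: (@two_legs_down 0 1 2).
Qed.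

End LegDirections.

Lemma no_induced_spider222 q (f : spider 2 2 2 -> nat) :
  ~ (forall u v, ladj q (f u) (f v) = edge u v).
Proof.
move=> fP.
pose leg i (d : 'I_2) : spider 2 2 2 :=
  match i with
  | 0 => Some (inl (inl d)) | 1 => Some (inl (inr d)) | _ => Some (inr d)
  end.
apply: (@no_three_legs q (f None) (fun i => f (leg i ord0))
          (fun i => f (leg i ord_max))) => [i|i|i j]; rewrite fP.
- by case: i => [|[|]].
- by case: i => [|[|]].
- by case: i => [|[|[|]]]; case: j => [|[|[|]]].
Qed.

(** * The circular graphs, cut open at a vertex *)

Lemma upE q x y : up q x y = (y <= x.+1) && (q %| x.+1 - y).
Proof.
rewrite /up andbC; case: leqP => //= le.
by rewrite eq_sym eqn_mod_dvd.
Qed.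

Lemma ladjxx q x : 1 < q -> ladj q x x = false.
Proof. by move=> q1; rewrite /ladj orbb upE leqnSn subSnn dvdn1 gtn_eqF. Qed.

Lemma ladj_lt q x y : x < y -> ladj q x y = (y == x.+1) || (q %| (y - x).+1).
Proof.
move=> lxy; rewrite /ladj !upE (_ : x <= y.+1) /=; last lia.
rewrite [y.+1 - x]subSn; last exact: ltnW.
congr (_ || _); rewrite [y == _]eqn_leq lxy andbT.
case: leqP => //= le; have -> : x.+1 - y = 0 by lia.
exact: dvdn0.
Qed.

(** [d] is the linear distance [|i - j|], and [N.-1] closes the cycle. If [q %| N.+2], then [d] and
    [N - d] pass the last test together. *)
Definition wadj (q N i j : nat) : bool :=
  let d := (i - j) + (j - i) in
  (i != j) && [|| d == 1, d == N.-1 | q %| d.+1].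

Lemma wadjC q N i j : wadj q N i j = wadj q N j i.
Proof. by rewrite /wadj eq_sym addnC. Qed.

Lemma wadj_lt q N i j : i < j ->
  wadj q N i j = [|| j == i.+1, j - i == N.-1 | q %| (j - i).+1].
Proof.
move=> lij; rewrite /wadj (_ : i - j = 0) ?add0n; last lia.
by rewrite ltn_eqF //=; congr (_ || _); lia.
Qed.

Lemma wadj_sym q N : symmetric (fun i j : 'I_N => wadj q N i j).
Proof. by move=> i j; apply: wadjC. Qed.

Lemma wadj_irrefl q N : irreflexive (fun i j : 'I_N => wadj q N i j).
Proof. by move=> i; rewrite /wadj eqxx. Qed.

Definition wgraph (q N : nat) : sgraph := SGraph (@wadj_sym q N) (@wadj_irrefl q N).

(* The position of [i] when the cyclic order is cut open at the vertex [w]. *)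
Definition unroll (N w i : nat) : nat := if i < w then i + N.-1 - w else i - w.+1.

Lemma ladj_unroll q N w i j : 1 < q -> q %| N.+2 ->
  w < N -> i < N -> j < N -> i != w -> j != w ->
  ladj q (unroll N w i) (unroll N w j) = wadj q N i j.
Proof.
move=> q1 qN lw; wlog lij : i j / i < j => [IH|] li lj iw jw.
  case: (ltngtP i j) => [lt|lt|<-]; first exact: IH.
    by rewrite ladjC wadjC; apply: IH.
  by rewrite ladjxx // /wadj eqxx.
rewrite wadj_lt //; case: (ltngtP i w) iw => // liw _;
  case: (ltngtP j w) jw => // ljw _; rewrite /unroll.
- rewrite liw ljw ladj_lt; last lia.
  have -> : j + N.-1 - w - (i + N.-1 - w) = j - i by lia.
  by rewrite (_ : (j - i == N.-1) = false); [congr (_ || _); lia|lia].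
(* The cut separates [i] from [j], so their distance [d] becomes [N - d]; in particular [N.-1]
   becomes 1. *)
- rewrite liw ltnNge (ltnW ljw) /= ladjC ladj_lt; last lia.
  rewrite (_ : (j == i.+1) = false) /=; last lia.
  congr (_ || _); first lia.
  rewrite (_ : (i + N.-1 - w - _).+1 = N.+2 - (j - i).+1); last lia.
  by rewrite dvdn_subr //; lia.
- lia.
- rewrite ltnNge (ltnW liw) ltnNge (ltnW ljw) /= ladj_lt; last lia.
  have -> : j - w.+1 - (i - w.+1) = j - i by lia.
  by rewrite (_ : (j - i == N.-1) = false); [congr (_ || _); lia|lia].
Qed.

(** A copy of [F] is too small to cover all vertices, so it misses some [w] where the cycle can be
    cut. *)
Lemma induced_in_line q N (F : sgraph) : 1 < q -> q %| N.+2 -> #|F| < N ->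
  contains_induced F (wgraph q N) ->
  exists g : F -> nat, forall u v, ladj q (g u) (g v) = edge u v.
Proof.
move=> q1 qN lF [f [_ fP]].
have /subsetPn[w _ wf] : ~~ ([set: 'I_N] \subset codom f).
  apply/negP => /subset_leq_card; rewrite cardsT card_ord.
  by move=> /leq_trans/(_ (leq_image_card f predT)); rewrite leqNgt lF.
have fw u : (f u : nat) != w.
  by apply: contraNneq wf => /ord_inj <-; apply: codom_f.
by exists (fun u => unroll N w (f u)) => u v; rewrite ladj_unroll // -fP.
Qed.

Lemma wgraph_proper_colorable q N (H : sgraph) (A : {set wgraph q N}) :
  1 < q -> q %| N.+2 -> contains_subgraph (cycle_graph q) H ->
  A \proper [set: wgraph q N] -> colorable H (induced A).
Proof.
move=> q1 qN [f [_ fP]] /properP[_ [w _ wA]].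
have q0 : 0 < q by lia.
pose p x := Ordinal (ltn_pmod x q0).
have upcyc x y : up q x y -> edge (p x : cycle_graph q) (p y).
  case/upP => e _; rewrite /edge /= /cycle_rel -val_eqE /= e.
  rewrite -[(x %% q).+1]addn1 modnDml addn1 eqxx /= andbT.
  rewrite -{1}[x]addn0 -[x.+1]addn1 eqn_modDl mod0n modn_small //.
exists (fun u => f (p (unroll N w (val u : 'I_N)))) => u v uv.
have nw (x : {x : wgraph q N | x \in A}) : (val x : 'I_N) != w :> nat.
  by apply: contraNneq wA => /ord_inj <-; apply: (valP x).
have : ladj q (unroll N w (val u : 'I_N)) (unroll N w (val v : 'I_N)).
  by rewrite ladj_unroll ?nw //; apply: uv.
case/orP => /upcyc; first exact: fP.
by rewrite edge_sym => /fP.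
Qed.

(** * Odd closed walks and non-colourability *)

Lemma odd_closed_walk (H : sgraph) (l : nat) (w : nat -> H) :
  odd l -> w l = w 0 -> (forall i, i < l -> edge (w i) (w i.+1)) ->
  exists n, [/\ n <= l, odd n & has_cycle H n].
Proof.
elim/ltn_ind: l w => l IH w ol wl0 we.
have [/forallP wI|] :=
    boolP [forall i : 'I_l, forall j : 'I_l, (i < j) ==> (w i != w j)].
  have l3 : 3 <= l.
    case: l ol wl0 we {IH wI} => [|[|[]]] // _ e /(_ 0 isT).
    by rewrite e edge_irrefl.
  have wI' (i j : 'I_l) : i < j -> w i <> w j.
    by move=> ij; apply/eqP; apply: (implyP (forallP (wI i) j)).
  exists l; split=> //; split=> //; exists (fun i : 'I_l => w i); split.
    move=> i j e; case: (ltngtP i j) => [/wI'|/wI'|/ord_inj] //.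
    by rewrite e.
  have wN (i j : 'I_l) : i.+1 %% l == j -> edge (w i) (w j).
    move/eqP <-; have := we i (ltn_ord i).
    have := ltn_ord i; rewrite leq_eqVlt => /orP[/eqP e|lt].
      by rewrite e modnn wl0.
    by rewrite modn_small.
  by move=> i j /andP[_ /orP[/wN|/wN]] //; rewrite edge_sym.
rewrite negb_forall => /existsP[i]; rewrite negb_forall => /existsP[j].
rewrite negb_imply negbK => /andP[ij /eqP eij].
have lj := ltn_ord j.
(* The repeated vertex splits the walk into two shorter closed walks, one of them odd. *)
have [od|ev] := boolP (odd (j - i)).
  have [||k lk|n [ln on cn]] := IH (j - i) _ (fun k => w (i + k)) od.
  - lia.
  - by rewrite addn0 subnKC // ltnW.
  - by rewrite addnS; apply: we; lia.
  - by exists n; split=> //; lia.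
pose w' k := if k <= i then w k else w (k + (j - i)).
have [||||n [ln on cn]] := IH (l - (j - i)) _ w'.
- lia.
- lia.
- rewrite /w' leq0n; case: leqP => le; first lia.
  by rewrite -wl0; congr w; lia.
- move=> k lk; rewrite /w'; case: (ltngtP k i) => [lt|gt|->].
  + by apply: we; lia.
  + by rewrite addSn; apply: we; lia.
  + by rewrite eij addSn subnKC ?(ltnW ij) //; apply: we.
- by exists n; split=> //; lia.
Qed.

Lemma common_neighbours_eq (H : sgraph) (x y u u' : H) :
  ~ contains_subgraph (cycle_graph 4) H -> x <> y ->
  edge x u -> edge u y -> edge x u' -> edge u' y -> u = u'.
Proof.
move=> noC4 xy xu uy xu' u'y; apply/eqP; apply: contra_notT noC4 => uu'.
have ne a b : edge a b -> a != b :> H.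
  by apply: contraTneq => ->; rewrite edge_irrefl.
exists (fun i : 'I_4 => nth x [:: x; u; y; u'] i); split.
  move=> i j /eqP; rewrite nth_uniq ?size_cat //=; first by move/eqP/ord_inj.
  rewrite !inE !negb_or (ne _ _ xu) (ne _ _ xu') (ne _ _ uy) uu' /=.
  by rewrite [y == u']eq_sym (ne _ _ u'y) andbT !andbT; apply/eqP.
move=> [[|[|[|[|i]]]] li] [[|[|[|[|j]]]] lj] //= _; rewrite // edge_sym //.
Qed.

Lemma wgraph_not_colorable q N (H : sgraph) :
  3 <= q -> odd q -> q %| N.+2 -> q < N ->
  (forall n, odd n -> has_cycle H n -> q <= n) ->
  ~ contains_subgraph (cycle_graph 4) H ->
  ~ colorable H (wgraph q N).
Proof.
move=> q3 oq qN ltqN girth noC4 [c cP].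
have N0 : 0 < N by lia.
pose c' i := c (Ordinal (ltn_pmod i N0)).
have c'N i : c' (i + N) = c' i.
  by rewrite /c'; congr c; apply: val_inj; rewrite /= modnDr.
have shift i d : 0 < d < N ->
    (i + d) %% N = i %% N + d \/ (i + d) %% N + (N - d) = i %% N.
  move=> ld; rewrite -modnDml; have lt := ltn_pmod i N0.
  case: (ltnP (i %% N + d) N) => le; first by left; rewrite modn_small.
  right; rewrite -[in LHS](subnK le) modnDr modn_small; lia.
have c'S i : edge (c' i) (c' i.+1).
  apply: cP; rewrite /edge /=; have := shift i 1 ltac:(lia).
  rewrite addn1 => -[e|e].
    by rewrite wadj_lt; [rewrite e addn1 eqxx|lia].
  rewrite wadjC wadj_lt; last lia.
  by apply/or3P; apply: Or32; lia.
have c'q i : edge (c' i) (c' (i + q.-1)).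
  apply: cP; rewrite /edge /=; have [e|e] := shift i q.-1 ltac:(lia).
    rewrite wadj_lt; last lia.
    by rewrite e addKn prednK ?dvdnn ?orbT //; lia.
  rewrite wadjC wadj_lt; last lia.
  rewrite -[in X in X - _]e addKn (_ : (N - q.-1).+1 = N.+2 - q); last lia.
  by rewrite dvdn_sub ?orbT.
have period i : c' (i + q) = c' i.
  apply: esym; apply: (common_neighbours_eq noC4 (x := c' i.+1) (y := c' (i + q.-1))).
  (* Equal colours would close the walk over [i + 1, ..., i + q - 1], whose odd length [q - 2] is
     below the odd girth. *)
  - move=> e.
    have [|||n [ln on cn]] := @odd_closed_walk H (q - 2) (fun k => c' (i.+1 + k)).
    + lia.
    + by rewrite addn0 e; congr c'; lia.
    + by move=> k _; rewrite addnS; apply: c'S.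
    + by have := girth n on cn; lia.
  - by rewrite edge_sym; apply: c'S.
  - exact: c'q.
  - by rewrite (_ : i + q = i.+1 + q.-1); [apply: c'q|lia].
  - by rewrite (_ : i + q = (i + q.-1).+1); [rewrite edge_sym; apply: c'S|lia].
have periodM i k : c' (i + k * q) = c' i.
  by elim: k => [|k IH]; [rewrite addn0|rewrite mulSn addnCA addnC period].
(* Since [N + 2] is a multiple of [q], the periods [N] and [q] yield the period 2. *)
have two i : c' i.+2 = c' i.
  have /dvdnP[k ek] := qN.
  by rewrite -[LHS]c'N -[RHS](periodM i k) -ek; congr c'; lia.
have even i k : c' (i + k.*2) = c' i.
  by elim: k => [|k IH]; [rewrite addn0|rewrite doubleS !addnS two].
(* Positions 1 and [q] share a colour by period 2, and so do [q] and 0 by period [q], yet 0 and 1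
   are adjacent. *)
have := c'S 0; rewrite -(even 1 q./2) (_ : 1 + q./2.*2 = 0 + q); last lia.
by rewrite period edge_irrefl.
Qed.

(** * Paths inside spiders, and the conclusion *)

Lemma path_in_path s t : s <= t -> contains_induced (path_graph s) (path_graph t).
Proof.
by move=> st; exists (widen_ord st); split=> // i j /(congr1 val) /= /ord_inj.
Qed.

Lemma contains_induced_trans (F G K : sgraph) :
  contains_induced F G -> contains_induced G K -> contains_induced F K.
Proof.
move=> [f [fI fP]] [g [gI gP]]; exists (g \o f); split; first exact: inj_comp.
by move=> u v; rewrite gP fP.
Qed.

(** The path runs inwards from the tip of the first leg, through the centre, and outwards along the
    second leg. *)
Lemma path_in_spider k c : contains_induced (path_graph (k + k).+1) (spider k k c).
Proof.
pose f (i : nat) : spider k k c :=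
  if i < k then omap (fun x => inl (inl x)) (insub (k - i.+1))
  else if i == k then None else omap (fun x => inl (inr x)) (insub (i - k.+1)).
have fP i : i < (k + k).+1 ->
    [\/ exists2 x : 'I_k, f i = Some (inl (inl x)) & i + x.+1 = k,
        f i = None /\ i = k
      | exists2 x : 'I_k, f i = Some (inl (inr x)) & i = k + x.+1].
  move=> li; rewrite /f; case: ltngtP => [ik|ki|->]; last exact: Or32.
    have l : k - i.+1 < k by lia.
    by apply: Or31; exists (Ordinal l); [rewrite insubT|rewrite /=; lia].
  have l : i - k.+1 < k by lia.
  by apply: Or33; exists (Ordinal l); [rewrite insubT|rewrite /=; lia].
have fE (i j : 'I_(k + k).+1) :
    (f i = f j -> i = j :> nat) /\ edge (f i) (f j) = consecutive i j.
  case: (fP i (ltn_ord i)) => [[x ->]|[->]|[x ->]] ei;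
    case: (fP j (ltn_ord j)) => [[y ->]|[->]|[y ->]] ej;
    rewrite /edge /= /spider_rel /= /consecutive;
    (split; [by [|case=> exy; move: ei ej; rewrite ?exy; lia|lia]|lia]).
exists (fun i : 'I_(k + k).+1 => f i); split=> [i j /(proj1 (fE i j))/ord_inj|i j] //.
exact: (proj2 (fE i j)).
Qed.

Theorem theorem4 (q : nat) (H : sgraph) :
  3 <= q -> odd q ->
  has_odd_girth H q ->
  ~ contains_subgraph (cycle_graph 4) H ->
  exists G : nat -> sgraph,
    (forall m n : nat, m <> n -> ~ isomorphic (G m) (G n)) /\
    (forall n : nat,
      [/\ minimal_obstruction H (G n),
          induced_free (path_graph (3 * q - 1)) (G n),
          induced_free (spider 2 2 2) (G n)
        & induced_free (spider (3 * (q - 1) %/ 2) (3 * (q - 1) %/ 2) 1) (G n)]).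
Proof.
move=> q3 oq [_ [_ cyc] girth] noC4.
(* This is [-2] modulo [q]; the offset 4 is the least that makes every [N n] exceed [3 * q - 2]. *)
pose N n := q * n.+4 - 2.
have qN n : q %| (N n).+2.
  by rewrite (_ : (N n).+2 = q * n.+4) ?dvdn_mulr // /N; nia.
have ltN n : 3 * q - 2 < N n by rewrite /N; nia.
exists (fun n => wgraph q (N n)); split=> [m n mn [f [/bij_eq_card]]|n].
  by rewrite !card_ord /N => e _; apply: mn; nia.
(* Excluding a path one vertex shorter than required also excludes the last spider, whose two long
   legs form such a path. *)
have Pfree : induced_free (path_graph (3 * q - 2)) (wgraph q (N n)).
  move=> /induced_in_line[||| g gP] //; [lia|by rewrite card_ord|].
  apply: (@no_induced_path q (fun i => if insub i is Some j then g j else 0)) => //.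
  by move=> i j li lj; rewrite !insubT gP.
split.
- split; last by move=> A; apply: wgraph_proper_colorable => //; lia.
  by apply: wgraph_not_colorable => //; have := ltN n; lia.
- by move/(contains_induced_trans (path_in_path _)) => /(_ (3 * q - 2)) h;
     apply: Pfree; apply: h; lia.
- move=> /induced_in_line[||| g] //; first lia; last exact: no_induced_spider222.
  rewrite card_option !card_sum !card_ord /=; have := ltN n; lia.
- set k := _ %/ 2 => h; apply: Pfree.
  have -> : 3 * q - 2 = (k + k).+1 by rewrite /k; lia.
  exact: contains_induced_trans (path_in_spider k 1) h.
Qed.
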